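(* Let $R$ be a commutative Noetherian ring with unity, let $\lambda$ be a length function on $R$-modules, let $k\in\mathbb{N}$, $S=R[x_1,\dots,x_k]$, and let $N$ be an $S$-module. Let $V_0\le N$ be an $R$-submodule which is finitely generated as an $R$-module and satisfies $\lambda(V_0)<\infty$. Then there exists a polynomial $q_{V_0}(t)\in\mathbb{R}[t]$ of degree at most $k$ such that $\lambda(S_nV_0)=q_{V_0}(n)$ for all sufficiently large $n\in\mathbb{N}$. Assume moreover that $N=SV_0=\bigcup_{n}S_nV_0$, and let $V_0'\le N$ be another finitely generated $R$-submodule with $\lambda(V_0')<\infty$ and $SV_0'=N$. Then there exists a constant $n_0\in\mathbb{N}$ such that $q_{V_0'}(t)\le q_{V_0}(t+n_0)$ (for all sufficiently large $t$), and $q_{V_0}$ and $q_{V_0'}$ have the same leading coefficient (and degree); thus this leading term depends only on $N$. Finally, the coefficient of $t^k$ in $q_{V_0}$ equals $h_\lambda(N)/k!$.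
   Context: A length function on the category of $R$-modules is a function $\lambda$ from $R$-modules to $\mathbb{R}_{\ge0}\cup\{\infty\}$ such that: $\lambda(0)=0$; $\lambda(M)=\lambda(M')$ whenever $M\cong M'$; $\lambda(B)=\lambda(A)+\lambda(C)$ for every exact sequence $0\to A\to B\to C\to 0$; and $\lambda(M)=\sup\{\lambda(M'): M'\le M \text{ finitely generated } R\text{-submodule}\}$. For $n\in\mathbb{N}$, $S_n$ denotes the $R$-submodule of $S$ of polynomials of total degree at most $n$, and $S_nV_0$ is the $R$-submodule of $N$ generated by products $pv$ with $p\in S_n$, $v\in V_0$. The algebraic entropy of the $S$-module $N$ is $h_\lambda(N)=\sup\{H(N;V): V\le N \text{ an } R\text{-submodule with } \lambda(V)<\infty\}$, where $H(N;V)=\lim_{n\to\infty}\lambda(S_nV)/\binom{n+k}{k}=k!\lim_{n\to\infty}\lambda(S_nV)/n^k$ (this limit exists). *)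

(* Defs.v *)
From HB Require Import structures.
From mathcomp Require Import all_boot all_order all_algebra.
From mathcomp Require Import all_classical all_reals.
From mathcomp Require Import Rstruct.
From mathcomp Require Import ereal topology normedtype sequences.

Set Implicit Arguments.
Unset Strict Implicit.
Unset Printing Implicit Defensive.

Import Order.TTheory GRing.Theory Num.Theory.
Local Open Scope ring_scope.
Local Open Scope classical_set_scope.

Notation Rr := Rdefinitions.R.

Section Submodules.
Variables (A : pzRingType) (M : lmodType A).

Definition submod (V : set M) : Prop :=
  V 0 /\ (forall (a : A) (x y : M), V x -> V y -> V (a *: x + y)).

Definition gen_sub (G : set M) : set M :=
  [set v | exists s : seq (A * M),
      (forall p, p \in s -> G p.2) /\ v = \sum_(p <- s) p.1 *: p.2].

Definition fingen (V : set M) : Prop :=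
  exists s : seq M, V = gen_sub [set x | x \in s].

End Submodules.

Section SubModuleType.
Variables (A : pzRingType) (M : lmodType A) (V : set M) (hV : submod V).

Record subm : Type := SubM { subm_val : M ; subm_prop : V subm_val }.

Lemma subm_eq (u v : subm) : subm_val u = subm_val v -> u = v.
Proof.
case: u => x hx; case: v => y hy /= exy; subst y.
by rewrite (Prop_irrelevance hx hy).
Qed.

HB.instance Definition _ := gen_eqMixin subm.
HB.instance Definition _ := gen_choiceMixin subm.

Lemma subm0 : V 0. Proof. by case: hV. Qed.
Lemma submD x y : V x -> V y -> V (x + y).
Proof. by move=> hx hy; have := hV.2 1 x y hx hy; rewrite scale1r. Qed.
Lemma submZ (a : A) x : V x -> V (a *: x).
Proof. by move=> hx; have := hV.2 a x 0 hx subm0; rewrite addr0. Qed.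
Lemma submN x : V x -> V (- x).
Proof. by move=> hx; rewrite -scaleN1r; apply: submZ. Qed.

Definition subm_zero : subm := SubM subm0.
Definition subm_opp (u : subm) : subm := SubM (submN (subm_prop u)).
Definition subm_add (u v : subm) : subm := SubM (submD (subm_prop u) (subm_prop v)).
Definition subm_scale (a : A) (u : subm) : subm := SubM (submZ a (subm_prop u)).

Lemma subm_addA : associative subm_add.
Proof. by move=> u v w; apply: subm_eq; rewrite /= addrA. Qed.
Lemma subm_addC : commutative subm_add.
Proof. by move=> u v; apply: subm_eq; rewrite /= addrC. Qed.
Lemma subm_add0 : left_id subm_zero subm_add.
Proof. by move=> u; apply: subm_eq; rewrite /= add0r. Qed.
Lemma subm_addN : left_inverse subm_zero subm_opp subm_add.
Proof. by move=> u; apply: subm_eq; rewrite /= addNr. Qed.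

HB.instance Definition _ :=
  GRing.isZmodule.Build subm subm_addA subm_addC subm_add0 subm_addN.

Lemma subm_scaleA a b v : subm_scale a (subm_scale b v) = subm_scale (a * b) v.
Proof. by apply: subm_eq; rewrite /= scalerA. Qed.
Lemma subm_scale1 : left_id 1 subm_scale.
Proof. by move=> v; apply: subm_eq; rewrite /= scale1r. Qed.
Lemma subm_scaleDr : right_distributive subm_scale subm_add.
Proof. by move=> a u v; apply: subm_eq; rewrite /= scalerDr. Qed.
Lemma subm_scaleDl v : {morph subm_scale^~ v : a b / a + b >-> subm_add a b}.
Proof. by move=> a b; apply: subm_eq; rewrite /= scalerDl. Qed.

HB.instance Definition _ :=
  GRing.Zmodule_isLmodule.Build A subm
    subm_scaleA subm_scale1 subm_scaleDr subm_scaleDl.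

Definition SubLmod : lmodType A := subm.

End SubModuleType.

(* λ(V) for a subset V of M: λ of V viewed as a module when V is a
   submodule (all proofs of submod V give the same module by proof
   irrelevance); -oo (empty sup) if V is not a submodule (never used). *)
Definition lamV (A : pzRingType) (lam : forall M : lmodType A, \bar Rr)
  (M : lmodType A) (V : set M) : \bar Rr :=
  ereal_sup [set x | exists hV : submod V, x = lam (SubLmod hV)].

Definition length_function (A : pzRingType)
  (lam : forall M : lmodType A, \bar Rr) : Prop :=
  [/\ (forall M : lmodType A, (0 <= lam M)%E),
      (forall M : lmodType A, (forall x : M, x = 0) -> lam M = 0%E),
      (forall (M M' : lmodType A) (f : {linear M -> M'}),
          bijective f -> lam M = lam M'),
      (forall (M1 M2 M3 : lmodType A) (f : {linear M1 -> M2})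
              (g : {linear M2 -> M3}),
          injective f -> (forall z, exists y, g y = z) ->
          (forall y, g y = 0 <-> exists x, f x = y) ->
          lam M2 = (lam M1 + lam M3)%E)
    & (forall M : lmodType A,
          lam M = ereal_sup [set x | exists V : set M,
                                     fingen V /\ x = lamV lam V])].

Definition noetherian (A : comPzRingType) : Prop :=
  forall I : set A^o, submod I -> fingen I.

(* S = A[x_1,...,x_k]-module structure on an A-module N: the (pairwise
   commuting, A-linear) actions xs i of the variables x_i. *)
Definition commuting_ops (A : pzRingType) (N : lmodType A) (k : nat)
  (xs : 'I_k -> {linear N -> N}) : Prop :=
  forall i j (v : N), xs i (xs j v) = xs j (xs i v).

Definition xmon (A : pzRingType) (N : lmodType A) (k : nat)
  (xs : 'I_k -> {linear N -> N}) (a : 'I_k -> nat) (v : N) : N :=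
  foldr (fun i w => iter (a i) (xs i) w) v (enum 'I_k).

Definition mdeg (k : nat) (a : 'I_k -> nat) : nat := (\sum_(i < k) a i)%N.

(* action of a polynomial p = \sum c_a x^a, given as a list of
   (coefficient, exponent vector) pairs *)
Definition pact (A : pzRingType) (N : lmodType A) (k : nat)
  (xs : 'I_k -> {linear N -> N}) (p : seq (A * ('I_k -> nat))) (v : N) : N :=
  \sum_(c <- p) c.1 *: xmon xs c.2 v.

Definition Sn (A : pzRingType) (N : lmodType A) (k : nat)
  (xs : 'I_k -> {linear N -> N}) (n : nat) (V : set N) : set N :=
  gen_sub [set w | exists (p : seq (A * ('I_k -> nat))) (v : N),
             all (fun c => (mdeg c.2 <= n)%N) p /\ V v /\ w = pact xs p v].

Definition SV (A : pzRingType) (N : lmodType A) (k : nat)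
  (xs : 'I_k -> {linear N -> N}) (V : set N) : set N :=
  \bigcup_n Sn xs n V.

Definition Hent (A : pzRingType) (lam : forall M : lmodType A, \bar Rr)
  (N : lmodType A) (k : nat) (xs : 'I_k -> {linear N -> N}) (V : set N)
  : \bar Rr :=
  limn (fun n => (lamV lam (Sn xs n V) * ((('C(n + k, k))%:R : Rr)^-1)%:E)%E).

Definition hent (A : pzRingType) (lam : forall M : lmodType A, \bar Rr)
  (N : lmodType A) (k : nat) (xs : 'I_k -> {linear N -> N}) : \bar Rr :=
  ereal_sup [set x | exists V : set N,
     [/\ submod V, (lamV lam V < +oo)%E & x = Hent lam xs V]].

Definition hilb_poly (A : pzRingType) (lam : forall M : lmodType A, \bar Rr)
  (N : lmodType A) (k : nat) (xs : 'I_k -> {linear N -> N}) (V0 : set N)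
  (q : {poly Rr}) : Prop :=
  (size q <= k.+1)%N /\
  exists n1 : nat, forall n : nat, (n1 <= n)%N ->
     lamV lam (Sn xs n V0) = (q.[n%:R])%:E.

(* Main.v *)
(* Fix a finitely generated V and order the monomials x^a by graded lexicographic
   order.  Let F_a be the span of the x^b V with b < a, and let K_a be the
   submodule of those v in V with x^a v in F_a.  Since V/K_a is isomorphic to
   (F_a + x^a V)/F_a, the length of S_n V is the sum over |a| <= n of
   lam(V) - lam(K_a).  Multiplication by monomials respects the order, so K_a
   grows with a; V is a Noetherian module, so the family K stabilises in each
   coordinate direction, and induction on the number of variables makes the sum
   eventually polynomial in n of degree at most k.

   If S V = N, every finitely generated W lies in some S_{n0} V, hence
   S_n W <= S_{n+n0} V; this yields the comparison of Hilbert polynomials.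
   A submodule W of finite length contains a finitely generated U with
   lam(W) <= lam(U) + e, and then lam(S_n W) <= lam(S_n U) + binom(n+k,k) e, so no
   W has entropy larger than that of V. *)

Require Import Defs.
From HB Require Import structures.
From mathcomp Require Import all_boot all_order all_algebra.
From mathcomp Require Import all_classical all_reals.
From mathcomp Require Import Rstruct.
From mathcomp Require Import ereal topology normedtype sequences.
From mathcomp Require Import zify ring lra.
From mathcomp Require Import polyrcf.
Import Order.TTheory GRing.Theory Num.Theory.
Local Open Scope ring_scope.
Local Open Scope classical_set_scope.

Set Implicit Arguments.
Unset Strict Implicit.
Unset Printing Implicit Defensive.

(** * Exponent vectors and the graded lexicographic order *)

(** Exponent vectors are lists, so that induction on the number of variables can peel off the first
    exponent. *)
Fixpoint monomials (k n : nat) : seq (seq nat) :=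
  if k is k'.+1 then
    flatten [seq [seq j :: a | a <- monomials k' (n - j)] | j <- iota 0 n.+1]
  else [:: [::]].

Lemma mem_monomials k n a :
  (a \in monomials k n) = (size a == k) && (sumn a <= n)%N.
Proof.
elim: k n a => [|k IHk] n a; first by case: a.
apply/flatten_mapP/andP => [[j]|[]].
  rewrite mem_iota => /andP[_ jn] /mapP[b]; rewrite IHk => /andP[/eqP sb bn] ->.
  by rewrite /= sb; split=> //; lia.
case: a => // j a /eqP[sa]; rewrite [sumn _]/= => le_n; exists j; first by rewrite mem_iota; lia.
by apply/mapP; exists a => //; rewrite IHk sa eqxx; lia.
Qed.

Lemma uniq_monomials k n : uniq (monomials k n).
Proof.
elim: k n => [|k IHk] n //=.
rewrite -[_ ++ _]/(flatten [seq [seq j :: a | a <- monomials k (n - j)]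
  | j <- iota 0 n.+1]).
apply: allpairs_uniq_dep (iota_uniq _ _) _ _ => [j _|p p' _ _ /= [e1 e2]] //.
by case: p p' e1 e2 => [i a] [j b] /= -> ->.
Qed.

Lemma size_monomials k n : size (monomials k n) = 'C(n + k, k).
Proof.
elim: k n => [|k IHk] n; first by rewrite bin0.
rewrite size_flatten /shape -map_comp sumnE big_map.
rewrite (eq_bigr (fun j => 'C(n - j + k, k)%N)); last first.
  by move=> j _; rewrite /= size_map IHk.
rewrite -[iota 0 n.+1]/(index_iota 0 n.+1).
elim: n => [|n IHn]; first by rewrite big_nat1 subnn !add0n !binn.
by rewrite big_nat_recl // subn0 IHn !addnS !addSn binS addnC.
Qed.

Lemma big_monomialsS (V : nmodType) k n (g : seq nat -> V) :
  \sum_(a <- monomials k.+1 n) g a =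
  \sum_(0 <= j < n.+1) \sum_(a <- monomials k (n - j)) g (j :: a).
Proof.
rewrite big_flatten big_map; apply: eq_bigr => j _.
by rewrite big_map.
Qed.

Fixpoint ltlex (a b : seq nat) : bool :=
  match a, b with
  | x :: a', y :: b' => (x < y)%N || (x == y) && ltlex a' b'
  | [::], _ :: _ => true
  | _, _ => false
  end.

(** Prefixing the total degree reduces the graded order to the plain lexicographic one, whose
    properties then transfer. *)
Definition grlex (a b : seq nat) : bool := ltlex (sumn a :: a) (sumn b :: b).

Definition addseq (a b : seq nat) : seq nat :=
  [seq (p.1 + p.2)%N | p <- zip a b].

Lemma ltlex_irr a : ltlex a a = false.
Proof. by elim: a => //= x a ->; rewrite ltnn eqxx. Qed.

Lemma ltlex_trans : transitive ltlex.
Proof.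
move=> b a c; elim: b a c => [|y b IH] [|x a] [|z c] //=.
case/orP=> [xy|/andP[/eqP <- ab]] /orP[yz|/andP[/eqP <- bc]].
- by rewrite (ltn_trans xy yz).
- by rewrite xy.
- by rewrite yz.
- by rewrite eqxx (IH _ _ ab bc) orbT.
Qed.

Lemma ltlex_total a b : a != b -> ltlex a b || ltlex b a.
Proof.
elim: a b => [|x a IH] [|y b] //=; rewrite eqseq_cons.
by case: (ltngtP x y) => //= _ ab; apply: IH.
Qed.

Lemma ltlex_addseq c a b : size a = size c -> size b = size c ->
  ltlex (addseq c a) (addseq c b) = ltlex a b.
Proof.
rewrite /addseq; elim: c a b => [|z c IH] [|x a] [|y b] //= [sa] [sb].
by rewrite ltn_add2l eqn_add2l IH.
Qed.

Lemma sumn_addseq a b : size a = size b ->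
  sumn (addseq a b) = (sumn a + sumn b)%N.
Proof.
by rewrite /addseq; elim: a b => [|x a IH] [|y b] //= [sab]; rewrite IH //; lia.
Qed.

Lemma size_addseq a b : size a = size b -> size (addseq a b) = size a.
Proof. by move=> sab; rewrite size_map size_zip sab minnn. Qed.

Lemma nth_addseq a b i : size a = size b ->
  nth 0%N (addseq a b) i = (nth 0 a i + nth 0 b i)%N.
Proof.
by rewrite /addseq; elim: a b i => [|x a IH] [|y b] [|i] //= [sab]; apply: IH.
Qed.

(** Componentwise order is divisibility of monomials; [c] is the exponent of the quotient. *)
Lemma all2_leq_addseq a b :
  all2 leq a b -> exists2 c, size c = size a & b = addseq c a.
Proof.
rewrite /addseq; elim: a b => [|x a IH] [|y b] //=; first by exists [::].
case/andP=> xy /IH[c sc ->]; exists ((y - x)%N :: c); first by rewrite /= sc.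
by rewrite /= subnK.
Qed.

Lemma all2_leqnn a : all2 leq a a.
Proof. by elim: a => //= x a ->; rewrite leqnn. Qed.

Lemma grlex_trans : transitive grlex.
Proof. by move=> b a c; apply: ltlex_trans. Qed.

Lemma grlex_irr a : grlex a a = false.
Proof. exact: ltlex_irr. Qed.

Lemma grlex_total a b : a != b -> grlex a b || grlex b a.
Proof. by move=> ab; apply: ltlex_total; apply: contraNN ab => /eqP[_ ->]. Qed.

Lemma grlex_sort (s : seq (seq nat)) : uniq s ->
  exists2 t, perm_eq t s & pairwise grlex t.
Proof.
(* Sorting uses the reflexive closure, which is total; strictness is recovered from the absence of
   duplicates. *)
move=> us; pose le a b := (a == b) || grlex a b.
have le_total : total le.
  move=> a b; rewrite /le eq_sym; case: eqVneq => //= ab.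
  by rewrite orbC grlex_total.
have le_trans : transitive le.
  move=> b a c /orP[/eqP -> //|ab] /orP[/eqP <-|bc]; rewrite /le ?ab ?orbT //.
  by rewrite (grlex_trans ab bc) orbT.
exists (sort le s); first by rewrite perm_sort.
have := sort_sorted le_total s; rewrite sorted_pairwise // => le_s.
have := sort_uniq le s; rewrite us uniq_pairwise => ne_s.
apply: (@sub_pairwise _ [rel a b | le a b && (a != b)]).
  by move=> a b /= /andP[/orP[/eqP ->|//]]; rewrite eqxx.
by rewrite pairwise_relI le_s.
Qed.

Lemma grlex_sumn a b : grlex a b -> (sumn a <= sumn b)%N.
Proof. by rewrite /grlex /=; case: ltngtP. Qed.

Lemma grlex_addseq c a b : size a = size c -> size b = size c ->
  grlex a b -> grlex (addseq c a) (addseq c b).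
Proof.
move=> sa sb; rewrite /grlex.
rewrite (sumn_addseq (esym sa)) (sumn_addseq (esym sb)).
by rewrite /= ltn_add2l eqn_add2l ltlex_addseq.
Qed.

(** * Stabilisation of monotone families over exponent vectors *)

Section Stabilisation.
Variables (T : Type) (P : set T -> Prop).
Hypothesis accP : forall c : nat -> set T, (forall n, P (c n)) ->
  (forall m n, (m <= n)%N -> c m `<=` c n) ->
  exists m, forall n, (m <= n)%N -> c n = c m.

(* Induction on [k]: for first exponents beyond the stabilisation index of the
   diagonal [m |-> F m (m :: a)] everything is squeezed between diagonal
   values, and only finitely many first exponents remain. *)
Lemma monotone_stabilises k (F : nat -> seq nat -> set T) :
  (forall m a, P (F m a)) ->
  (forall m n a b, (m <= n)%N -> size a = k -> all2 leq a b ->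
     F m a `<=` F n b) ->
  exists m, forall n a, (m <= n)%N -> size a = k -> F n a = F m a.
Proof.
elim: k F => [|k IHk] F PF monF.
  have [|m n le_mn|m Hm] := accP (c := fun m => F m [::]) => //.
    exact: monF.
  by exists m => n [|//] /Hm.
have [//|m n a b le_mn sa ab|d Hd] := IHk (fun m a => F m (m :: a)).
  by apply: monF => //=; [rewrite sa|rewrite le_mn].
have fin j : exists m, forall n a, (m <= n)%N -> size a = k ->
    F n (j :: a) = F m (j :: a).
  by apply: IHk => // m n a b le_mn sa ab; apply: monF => //=; [rewrite sa|rewrite leqnn].
have [f Hf] := choice fin.
(* The sum dominates every [f j] with [j < d] at once; the summand [d] serves the first exponents
   from [d] on. *)
pose m0 := (d + \sum_(j < d) f j)%N.
exists m0 => n [//|j a] le_n [sa].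
case: (ltnP j d) => [lt_jd|le_dj].
  have le_f : (f j <= m0)%N.
    by rewrite /m0 (bigD1 (Ordinal lt_jd)) //=; lia.
  by rewrite (Hf j n) ?(Hf j m0) // (leq_trans le_f).
have squeeze m : (d <= m)%N -> F m (j :: a) = F d (d :: a).
  move=> le_dm; apply/seteqP; split; last first.
    by apply: monF => //=; [rewrite sa|rewrite le_dj all2_leqnn].
  rewrite -(Hd (maxn m j) a) //; last by rewrite leq_max le_dm.
  by apply: monF => /=; [rewrite leq_maxl|rewrite sa|rewrite leq_maxr all2_leqnn].
have d_m0 : (d <= m0)%N by exact: leq_addr.
by rewrite !squeeze // (leq_trans d_m0).
Qed.

End Stabilisation.

(** * Eventually polynomial functions *)

Section EventuallyPoly.
Variable R : realFieldType.
Implicit Types (p q : {poly R}) (f : nat -> R).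

(** [d] bounds the size, so the degree is below [d] and [evpoly 0] means eventually zero. *)
Definition evpoly (d : nat) f : Prop :=
  exists q, (size q <= d)%N /\
    exists n1, forall n, (n1 <= n)%N -> f n = q.[n%:R].

Lemma evpolyD d f g : evpoly d f -> evpoly d g -> evpoly d (fun n => f n + g n).
Proof.
move=> [p [sp [n1 Hp]]] [q [sq [n2 Hq]]]; exists (p + q); split.
  by rewrite (leq_trans (size_polyD _ _)) // geq_max sp sq.
by exists (n1 + n2)%N => n le_n; rewrite hornerD Hp ?Hq //; lia.
Qed.

Lemma evpoly_sum d (s : seq nat) (F : nat -> nat -> R) :
  (forall j, j \in s -> evpoly d (F j)) ->
  evpoly d (fun n => \sum_(j <- s) F j n).
Proof.
elim: s => [|j s IHs] Hs.
  exists 0; rewrite size_poly0; split=> //.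
  by exists 0%N => n _; rewrite big_nil horner0.
have [||q [sq [n1 Hq]]] := @evpolyD d (F j) (fun n => \sum_(i <- s) F i n).
- by apply: Hs; rewrite mem_head.
- by apply: IHs => i si; apply: Hs; rewrite inE si orbT.
by exists q; split=> //; exists n1 => n /Hq <-; rewrite big_cons.
Qed.

Lemma evpolyW d e f : (d <= e)%N -> evpoly d f -> evpoly e f.
Proof. by move=> de [q [sq Hq]]; exists q; split=> //; exact: leq_trans de. Qed.

Lemma evpoly_shiftl d f j : evpoly d f -> evpoly d (fun n => f (n - j)%N).
Proof.
move=> [q [sq [n1 Hq]]]; exists (q \Po ('X - j%:R%:P)).
rewrite size_comp_poly2 ?size_XsubC //; split=> //.
(* From [n1 + j] on, the subtraction is not truncated and [n - j] has reached [n1]. *)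
exists (n1 + j)%N => n le_n; rewrite Hq ?horner_comp; last by lia.
by rewrite !hornerE natrB //; lia.
Qed.

(** The forward difference of X^(d+1) has leading term (d+1) X^d, so a multiple of X^(d+1) removes
    the coefficient of degree [d] and induction handles the rest. *)
Lemma antidifference d p : (size p <= d)%N ->
  exists2 q : {poly R}, (size q <= d.+1)%N & q \Po ('X + 1) - q = p.
Proof.
elim: d p => [|d IHd] p sp.
  exists 0; first by rewrite size_poly0.
  by rewrite comp_poly0 subrr; apply/esym/eqP; rewrite -size_poly_leq0.
pose r : {poly R} := (p`_d / d.+1%:R) *: 'X^(d.+1).
have szr : (size (p - (r \Po ('X + 1) - r) : {poly R})%R <= d)%N.
  apply/leq_sizeP => j le_dj; rewrite !coefB /r comp_polyZ !coefZ comp_Xn_poly.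
  rewrite exprD1n coef_sum coefXn.
  under eq_bigr => i _ do rewrite coefMn coefXn.
  (* Coefficients above [d] vanish; at [d], the binomial C(d+1, d) = d+1 clears the denominator of
     [r]. *)
  case: (ltngtP j d.+1) => [lt_j|gt_j|->]; last first.
  - rewrite (nth_default _ (leq_trans sp _)) // (bigD1 ord_max) //= eqxx binn.
    rewrite big1 ?addr0 ?subrr ?subr0 //.
    move=> i; rewrite -val_eqE /= eq_sym => /negPf ->; exact: mul0rn.
  - rewrite nth_default ?(leq_trans sp) // 1?ltnW // big1 ?mulr0 ?subrr //.
    move=> i _; suff -> : (j == i) = false by exact: mul0rn.
    by apply/eqP => ji; have := ltn_ord i; lia.
  - have -> : j = d by lia.
    have dS : (d < d.+2)%N by lia.
    rewrite (bigD1 (Ordinal dS)) //= eqxx binSn big1 ?addr0.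
      by rewrite mulr0 subr0 divfK ?subrr // pnatr_eq0.
    move=> i; rewrite -val_eqE /= eq_sym => /negPf ->; exact: mul0rn.
have [q sq Eq] := IHd _ szr; exists (q + r).
  rewrite (leq_trans (size_polyD _ _)) // geq_max (leq_trans sq) //=.
  by rewrite (leq_trans (size_scale_leq _ _)) // size_polyXn.
by rewrite comp_polyD opprD addrACA Eq subrK.
Qed.

(** The sum telescopes through an antidifference [q]. Its inclusive upper end causes the shift by
    one, and [c] accounts for the initial terms, where [f] may differ from [p]. *)
Lemma evpoly_series d f : evpoly d f ->
  evpoly d.+1 (fun n => \sum_(0 <= j < n.+1) f j).
Proof.
move=> [p [sp [n1 Hp]]]; have [q sq Eq] := antidifference sp.
pose c := \sum_(0 <= j < n1) f j - q.[n1%:R].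
exists (q \Po ('X + 1) + c%:P); split.
  rewrite (leq_trans (size_polyD _ _)) // geq_max.
  rewrite size_comp_poly2 ?sq; last by rewrite -polyC1 size_XaddC.
  by rewrite (leq_trans (size_polyC_leq1 _)).
have step n : p.[n%:R] = q.[n.+1%:R] - q.[n%:R].
  by rewrite -Eq hornerD hornerN horner_comp !hornerE natr1.
have Eqc n : (q \Po ('X + 1) + c%:P).[n%:R] = q.[n.+1%:R] + c.
  by rewrite hornerD hornerC horner_comp !hornerE natr1.
exists n1 => n /subnK <-; rewrite Eqc; elim: (n - n1)%N => [|m IH].
  by rewrite add0n big_nat_recr //= Hp // step /c; ring.
by rewrite addSn big_nat_recr //= IH Hp ?step; [ring|lia].
Qed.

Lemma evpoly_series_rev d f : evpoly d f ->
  evpoly d.+1 (fun n => \sum_(0 <= j < n.+1) f (n - j)%N).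
Proof.
move=> /evpoly_series [q [sq [n1 Hq]]]; exists q; split=> //; exists n1 => n.
move=> /Hq <-; rewrite big_nat_rev /=; apply: eq_big_nat => j /andP[_ jn].
by congr f; lia.
Qed.

Section Hilbert.
Variables (T : Type) (P : set T -> Prop) (g : set T -> R).
Hypothesis accP : forall c : nat -> set T, (forall n, P (c n)) ->
  (forall m n, (m <= n)%N -> c m `<=` c n) ->
  exists m, forall n, (m <= n)%N -> c n = c m.

(** Monomials are grouped by first exponent [j], and each group is eventually polynomial by
    induction. From some [m] on the groups use the same sets, so the tail is a summation of one
    function and gains a degree; the finite head gains none. *)
Lemma evpoly_monomials k (F : seq nat -> set T) :
  (forall a, P (F a)) ->
  (forall a b, size a = k -> all2 leq a b -> F a `<=` F b) ->
  evpoly k.+1 (fun n => \sum_(a <- monomials k n) g (F a)).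
Proof.
elim: k F => [|k IHk] F PF monF.
  exists (g (F [::]))%:P; rewrite size_polyC_leq1; split=> //.
  by exists 0%N => n _; rewrite /= big_seq1 hornerC.
(* The first exponent serves as the chain index, which makes [m] uniform in the remaining
   exponents. *)
have [//|m n a b mn sa ab|m Hm] :=
  monotone_stabilises accP (k := k) (F := fun j a => F (j :: a)).
  by apply: monF => //=; [rewrite sa|rewrite mn].
pose G j n := \sum_(a <- monomials k n) g (F (j :: a)).
have evG j : evpoly k.+1 (G j).
  by apply: IHk => // a b sa ab; apply: monF => //=; [rewrite sa|rewrite leqnn].
have [q [sq [n1 Hq]]] : evpoly k.+2 (fun n =>
    \sum_(j <- iota 0 m) G j (n - j)%N +
    \sum_(0 <= j < (n - m).+1) G m (n - m - j)%N).
  apply: evpolyD; last first.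
    exact: (evpoly_shiftl (f := fun n => \sum_(0 <= j < n.+1) G m (n - j)%N) m
      (evpoly_series_rev (evG m))).
  apply: evpoly_sum => j _; apply: (@evpolyW k.+1) => //.
  exact: evpoly_shiftl.
exists q; split=> //; exists (n1 + m)%N => n le_n.
rewrite -Hq; last by lia.
rewrite big_monomialsS (big_cat_nat (n := m)) //=; last by lia.
congr (_ + _); first by rewrite /index_iota subn0.
rewrite -{1}[m]add0n big_addn -subSn; last by lia.
apply: eq_big_nat => j /andP[_ jn]; rewrite /G -subnDA [(j + m)%N]addnC.
rewrite big_seq [RHS]big_seq; apply: eq_bigr => a.
by rewrite mem_monomials => /andP[/eqP sa _]; rewrite (Hm (m + j)%N) // leq_addr.
Qed.

End Hilbert.
End EventuallyPoly.

(** * Submodules, quotients and chains *)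

Section Generation.
Variables (A : pzRingType) (M : lmodType A).
Implicit Types (G U V : set M).

Lemma gen_sub_submod G : submod (gen_sub G).
Proof.
split; first by exists [::]; rewrite big_nil.
move=> a _ _ [s [sG ->]] [t [tG ->]].
exists ([seq (a * p.1, p.2) | p <- s] ++ t); split.
  by move=> p; rewrite mem_cat => /orP[/mapP[p' /sG ? ->]|/tG].
rewrite big_cat big_map scaler_sumr /=; congr (_ + _).
by apply: eq_bigr => p _; rewrite scalerA.
Qed.

Lemma sub_gen_sub G : G `<=` gen_sub G.
Proof.
move=> x Gx; exists [:: (1, x)]; split; last by rewrite big_seq1 scale1r.
by move=> p; rewrite inE => /eqP ->.
Qed.

Lemma gen_sub_min G V : submod V -> G `<=` V -> gen_sub G `<=` V.
Proof.
move=> hV GV _ [s [sG ->]]; rewrite big_seq.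
apply: (big_ind V) => [|x y|p /sG /GV]; first exact: subm0.
  exact: submD.
exact: submZ.
Qed.

Lemma gen_sub_mono G G' : G `<=` G' -> gen_sub G `<=` gen_sub G'.
Proof.
move=> GG'; apply: gen_sub_min; first exact: gen_sub_submod.
exact: subset_trans GG' (@sub_gen_sub _).
Qed.

Lemma fingen_submod V : fingen V -> submod V.
Proof. by move=> [s ->]; exact: gen_sub_submod. Qed.

Lemma submI U V : submod U -> submod V -> submod (U `&` V).
Proof.
move=> hU hV; split; first by split; exact: subm0.
by move=> a x y [Ux Vx] [Uy Vy]; split; [apply: hU.2|apply: hV.2].
Qed.

Lemma submB V x y : submod V -> V x -> V y -> V (x - y).
Proof. by move=> hV Vx Vy; apply: submD => //; apply: submN. Qed.

Lemma submod_addsub U V (f : {linear M -> M}) : submod U -> submod V ->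
  submod [set x | exists u v, [/\ U u, V v & x = u + f v]].
Proof.
move=> hU hV; split.
  by exists 0, 0; split; rewrite ?linear0 ?addr0 //; exact: subm0.
move=> a _ _ [u [v [Uu Vv ->]]] [u' [v' [Uu' Vv' ->]]].
exists (a *: u + u'), (a *: v + v'); split; [exact: hU.2|exact: hV.2|].
by rewrite linearP scalerDr addrACA.
Qed.

Lemma submod_chain_bigcup (c : nat -> set M) : (forall n, submod (c n)) ->
  (forall m n, (m <= n)%N -> c m `<=` c n) -> submod (\bigcup_n c n).
Proof.
move=> hc monc; split; first by exists 0%N => //; exact: subm0.
move=> a x y [m _ cx] [n _ cy]; exists (maxn m n) => //.
by apply: (hc _).2; [apply: monc cx; exact: leq_maxl|apply: monc cy; exact: leq_maxr].
Qed.

Lemma fingen_chain (c : nat -> set M) V : (forall n, submod (c n)) ->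
  (forall m n, (m <= n)%N -> c m `<=` c n) ->
  fingen V -> V `<=` \bigcup_n c n -> exists n, V `<=` c n.
Proof.
move=> hc monc [s ->] sub.
suff [n Hn] : exists n, forall x, x \in s -> c n x.
  by exists n; apply: gen_sub_min.
have {sub} : forall x, x \in s -> (\bigcup_n c n) x.
  by move=> x xs; apply: sub; apply: sub_gen_sub.
elim: s => [|x s IHs] sub; first by exists 0%N.
have [|n Hn] := IHs; first by move=> y ys; apply: sub; rewrite inE ys orbT.
have [m _ Hm] := sub x (mem_head _ _).
exists (maxn m n) => y; rewrite inE => /orP[/eqP ->|/Hn cy].
  by apply: monc Hm; exact: leq_maxl.
by apply: monc cy; exact: leq_maxr.
Qed.

End Generation.

Section Noetherian.
Variables (A : comPzRingType) (hA : noetherian A) (M : lmodType A).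

Lemma noetherian_chain (I : nat -> set A^o) : (forall n, submod (I n)) ->
  (forall m n, (m <= n)%N -> I m `<=` I n) ->
  exists m, forall n, (m <= n)%N -> I n `<=` I m.
Proof.
move=> hI monI.
have [m Hm] := fingen_chain hI monI (hA (submod_chain_bigcup hI monI))
  (@subset_refl _ _).
by exists m => n _ x Inx; apply: Hm; exists n.
Qed.

(* Induction on the generators [x :: s]: a submodule of the span is determined
   by its intersection with the span of [s] and its ideal of coefficients
   of [x]. *)
Lemma fingen_acc (V : set M) : fingen V -> forall c : nat -> set M,
  (forall n, submod (c n) /\ c n `<=` V) ->
  (forall m n, (m <= n)%N -> c m `<=` c n) ->
  exists m, forall n, (m <= n)%N -> c n = c m.
Proof.
move=> [s ->] c hc monc.
suff [m Hm] : exists m, forall n, (m <= n)%N -> c n `<=` c m.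
  by exists m => n mn; apply/seteqP; split; [exact: Hm|exact: monc].
have {hc} [hc cV] : (forall n, submod (c n)) /\
    forall n, c n `<=` gen_sub [set x | x \in s].
  by split=> n; case: (hc n).
elim: s c hc monc cV => [|x s IHs] c hc monc cV.
  exists 0%N => n _ y /cV; suff sub0 : gen_sub [set x | x \in [::]] `<=` c 0%N.
    exact: sub0.
  by apply: gen_sub_min.
pose W := gen_sub [set y | y \in s].
have hW : submod W by exact: gen_sub_submod.
pose I n : set A^o := [set a | exists2 w, W w & c n (a *: x + w)].
have hI n : submod (I n).
  split; first by exists 0; [exact: subm0|rewrite scale0r addr0; exact: subm0].
  move=> a b b' [w Ww cw] [w' Ww' cw']; exists (a *: w + w').
    exact: hW.2.
  have := (hc n).2 a _ _ cw cw'.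
  by rewrite scalerDr scalerA addrACA -scalerDl.
have monI m n : (m <= n)%N -> I m `<=` I n.
  by move=> mn a [w Ww cw]; exists w => //; apply: monc cw.
have [m1 Hm1] := noetherian_chain hI monI.
have [|||m2 Hm2] := IHs (fun n => c n `&` W).
- by move=> n; exact: submI.
- by move=> m n mn y [cy Wy]; split=> //; apply: monc cy.
- by move=> n y [].
pose m := maxn m1 m2; exists m => n mn u cu.
have [m1m m2m] : (m1 <= m)%N /\ (m2 <= m)%N by rewrite leq_maxl leq_maxr.
have decomp : gen_sub [set y | y \in x :: s] `<=`
    [set y | exists (a : A) w, W w /\ y = a *: x + w].
  apply: gen_sub_min; last first.
    move=> y /=; rewrite inE => /orP[/eqP ->|ys].
      by exists 1, 0; rewrite scale1r addr0; split=> //; exact: subm0.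
    by exists 0, y; rewrite scale0r add0r; split=> //; exact: sub_gen_sub.
  split; first by exists 0, 0; rewrite scale0r addr0; split=> //; exact: subm0.
  move=> a _ _ [b [w [Ww ->]]] [b' [w' [Ww' ->]]].
  exists (a * b + b'), (a *: w + w'); split; first exact: hW.2.
  by rewrite scalerDr scalerA addrACA -scalerDl.
have [a [w [Ww Eu]]] := decomp _ (cV _ _ cu).
have [w' Ww' cw'] : I m a.
  apply: (monI m1) => //; apply: (Hm1 n); first exact: leq_trans mn.
  by exists w => //; rewrite -Eu.
(* [u] and [a *: x + w'] share the coefficient of [x], so their difference lies in [W], where the
   chain is already stable. *)
have : (c m2 `&` W) (u - (a *: x + w')).
  apply: (Hm2 n); first exact: leq_trans mn.
  split; first by apply: submB => //; apply: monc cw'.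
  by rewrite Eu opprD addrACA subrr add0r; apply: submB.
move=> [/(monc _ _ m2m) cu' _].
by rewrite -(subrK (a *: x + w') u); apply: submD.
Qed.

End Noetherian.

(* Classes modulo [U] are represented by chosen members, so that the quotient
   is carried by a subtype of [M]. *)
Definition coset_repr (A : pzRingType) (M : lmodType A) (U : set M) (x : M) : M :=
  xget 0 [set y | U (x - y)].

Record quotm (A : pzRingType) (M : lmodType A) (U : set M) (hU : submod U) : Type :=
  QuotM { quotm_val : M; quotm_prop : coset_repr U quotm_val = quotm_val }.

Section QuotientModule.
Variables (A : pzRingType) (M : lmodType A) (U : set M) (hU : submod U).
Local Notation r := (coset_repr U).
Local Notation Q := (quotm hU).

Lemma coset_reprP x : U (x - r x).
Proof.
(* The class contains [x] itself, so [xget] never falls back on its default. *)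
apply: (@xgetPex _ 0 [set y | U (x - y)]); exists x.
by rewrite /= subrr; exact: subm0.
Qed.

Lemma coset_repr_eq x y : r x = r y <-> U (x - y).
Proof.
split=> [e|Uxy].
  have := submB hU (coset_reprP x) (coset_reprP y).
  by rewrite e opprD opprK addrACA [- r y + _]addrC subrr addr0.
(* Congruent elements have the same class as a set, and the chosen member depends on that set
   alone. *)
rewrite /coset_repr; congr (xget _ _); apply/seteqP; split=> z /= Uz.
  have := submB hU Uz Uxy.
  by rewrite opprB addrC subrKA.
have := submD hU Uxy Uz.
by rewrite addrA subrK.
Qed.

Lemma coset_repr_id x : r (r x) = r x.
Proof.
apply/coset_repr_eq; rewrite -opprB; apply: submN => //; exact: coset_reprP.
Qed.

Definition quotm_pi (x : M) : Q := QuotM hU (coset_repr_id x).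

Lemma quotm_eq (u v : Q) : quotm_val u = quotm_val v -> u = v.
Proof.
case: u => x hx; case: v => y hy /= exy; subst y.
by rewrite (Prop_irrelevance hx hy).
Qed.

Lemma quotm_piP x y : quotm_pi x = quotm_pi y <-> U (x - y).
Proof.
rewrite -coset_repr_eq; split=> [/(congr1 (@quotm_val _ _ _ _))|e] //.
exact: quotm_eq.
Qed.

Lemma quotm_valK u : quotm_pi (quotm_val u) = u.
Proof. by apply: quotm_eq; case: u. Qed.

HB.instance Definition _ := gen_eqMixin Q.
HB.instance Definition _ := gen_choiceMixin Q.

Definition quotm_zero : Q := quotm_pi 0.
Definition quotm_opp (u : Q) : Q := quotm_pi (- quotm_val u).
Definition quotm_add (u v : Q) : Q := quotm_pi (quotm_val u + quotm_val v).
Definition quotm_scale (a : A) (u : Q) : Q := quotm_pi (a *: quotm_val u).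

Lemma quotm_pi_add x y : quotm_add (quotm_pi x) (quotm_pi y) = quotm_pi (x + y).
Proof.
apply/quotm_piP; rewrite /= opprD addrACA -opprB -[r y - y]opprB -opprD.
by apply: submN => //; apply: submD => //; exact: coset_reprP.
Qed.

Lemma quotm_pi_scale a x : quotm_scale a (quotm_pi x) = quotm_pi (a *: x).
Proof.
apply/quotm_piP; rewrite /= -scalerBr -opprB; apply: submZ => //.
by apply: submN => //; exact: coset_reprP.
Qed.

Lemma quotm_pi_opp x : quotm_opp (quotm_pi x) = quotm_pi (- x).
Proof.
apply/quotm_piP; rewrite /= opprK addrC; exact: coset_reprP.
Qed.

Lemma quotm_addA : associative quotm_add.
Proof.
move=> u v w; rewrite -(quotm_valK u) -(quotm_valK v) -(quotm_valK w).
by rewrite !quotm_pi_add addrA.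
Qed.
Lemma quotm_addC : commutative quotm_add.
Proof. by move=> u v; rewrite /quotm_add addrC. Qed.
Lemma quotm_add0 : left_id quotm_zero quotm_add.
Proof. by move=> u; rewrite -(quotm_valK u) quotm_pi_add add0r. Qed.
Lemma quotm_addN : left_inverse quotm_zero quotm_opp quotm_add.
Proof.
by move=> u; rewrite -(quotm_valK u) quotm_pi_opp quotm_pi_add addNr.
Qed.

HB.instance Definition _ :=
  GRing.isZmodule.Build Q quotm_addA quotm_addC quotm_add0 quotm_addN.

Lemma quotm_scaleA a b v : quotm_scale a (quotm_scale b v) = quotm_scale (a * b) v.
Proof. by rewrite -(quotm_valK v) !quotm_pi_scale scalerA. Qed.
Lemma quotm_scale1 : left_id 1 quotm_scale.
Proof. by move=> v; rewrite -(quotm_valK v) quotm_pi_scale scale1r. Qed.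
Lemma quotm_scaleDr : right_distributive quotm_scale quotm_add.
Proof.
move=> a u v; rewrite -(quotm_valK u) -(quotm_valK v).
by rewrite !(quotm_pi_add, quotm_pi_scale) scalerDr.
Qed.
Lemma quotm_scaleDl v :
  {morph quotm_scale^~ v : a b / a + b >-> quotm_add a b}.
Proof.
move=> a b; rewrite -(quotm_valK v).
by rewrite !(quotm_pi_add, quotm_pi_scale) scalerDl.
Qed.

HB.instance Definition _ :=
  GRing.Zmodule_isLmodule.Build A Q
    quotm_scaleA quotm_scale1 quotm_scaleDr quotm_scaleDl.

Lemma quotm_pi_linear : linear quotm_pi.
Proof.
move=> a x y; rewrite -quotm_pi_add -quotm_pi_scale; exact: erefl.
Qed.

HB.instance Definition _ :=
  GRing.isLinear.Build A M Q *:%R quotm_pi quotm_pi_linear.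

Lemma quotm_pi_eq0 x : quotm_pi x = 0 <-> U x.
Proof. by rewrite -[0]/(quotm_pi 0) quotm_piP subr0. Qed.

End QuotientModule.

(** * Length functions on submodules *)

(** Bundles linear maps built within a proof, such as the inclusion and the corestriction in
    [lamV_ker_im]. *)
Lemma linear_pack (A : pzRingType) (M M' : lmodType A) (f : M -> M') :
  linear f -> exists g : {linear M -> M'}, g =1 f.
Proof.
move=> flin; pose m := GRing.isLinear.Build A M M' *:%R f flin.
by exists (HB.pack_for {linear M -> M'} f m).
Qed.

Lemma submod_ker (A : pzRingType) (M M' : lmodType A) (f : {linear M -> M'}) :
  submod [set x | f x = 0].
Proof.
split; first exact: linear0.
by move=> a x y /= fx fy; rewrite linearP fx fy scaler0 addr0.
Qed.

Lemma submod_image (A : pzRingType) (M M' : lmodType A) (f : {linear M -> M'})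
  (V : set M) : submod V -> submod (f @` V).
Proof.
move=> hV; split; first by exists 0; rewrite ?linear0 //; exact: subm0.
move=> a _ _ [x Vx <-] [y Vy <-]; exists (a *: x + y); first exact: hV.2.
by rewrite linearP.
Qed.

Section LengthFunction.
Variables (A : pzRingType) (lam : forall M : lmodType A, \bar Rr).
Hypothesis hlam : length_function lam.
Local Open Scope ereal_scope.

Lemma lamVE (M : lmodType A) (V : set M) (hV : submod V) :
  lamV lam V = lam (SubLmod hV).
Proof.
rewrite /lamV; suff -> : [set x | exists hV0 : submod V, x = lam (SubLmod hV0)]
  = [set lam (SubLmod hV)] by rewrite ereal_sup1.
apply/seteqP; split=> x /=; last by exists hV.
by move=> [hV' ->]; rewrite (Prop_irrelevance hV' hV).
Qed.

Lemma lamV_ge0 (M : lmodType A) (V : set M) : submod V -> 0 <= lamV lam V.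
Proof. by move=> hV; rewrite lamVE; case: hlam. Qed.

(** Additivity on the exact sequence from the kernel of [f] on [V], through [V], onto its image. All
    later additivity arguments go through this form. *)
Lemma lamV_ker_im (M M' : lmodType A) (f : {linear M -> M'}) (V : set M) :
  submod V ->
  lamV lam V = lamV lam (V `&` [set x | f x = 0%R]) + lamV lam (f @` V).
Proof.
move=> hV; have hK := submI hV (submod_ker f); have hI := submod_image f hV.
rewrite !lamVE; case: hlam => _ _ _ exact_seq _.
pose i (x : SubLmod hK) : SubLmod hV := SubM (subm_prop x).1.
pose p (x : SubLmod hV) : SubLmod hI := SubM (imageP f (subm_prop x)).
have [i' Ei] : exists i' : {linear SubLmod hK -> SubLmod hV}, i' =1 i.
  by apply: linear_pack => a x y; apply: subm_eq.
have [p' Ep] : exists p' : {linear SubLmod hV -> SubLmod hI}, p' =1 p.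
  by apply: linear_pack => a x y; apply: subm_eq; rewrite /= linearP.
apply: (exact_seq _ _ _ i' p').
- move=> x y; rewrite !Ei => /(congr1 (@subm_val _ _ _)) /= e.
  exact: subm_eq.
- move=> [y Iy]; have [x Vx fx] := Iy.
  by exists (SubM Vx); rewrite Ep; apply: subm_eq.
- move=> y; rewrite Ep; split.
    move=> /(congr1 (@subm_val _ _ _)) /= fy.
    exists (SubM (conj (subm_prop y) fy)); rewrite Ei.
    exact: subm_eq.
  move=> [x <-]; rewrite Ei; apply: subm_eq => /=.
  by have [] := subm_prop x.
Qed.

Lemma lamV_image_le (M M' : lmodType A) (f : {linear M -> M'}) (V : set M) :
  submod V -> lamV lam (f @` V) <= lamV lam V.
Proof.
move=> hV; rewrite (lamV_ker_im f hV) leeDr //; apply: lamV_ge0.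
exact: submI hV (submod_ker f).
Qed.

Section Quotient.
Variables (M : lmodType A) (U : set M) (hU : submod U).

Lemma lamV_quot (V : set M) : submod V -> U `<=` V ->
  lamV lam V = lamV lam U + lamV lam (quotm_pi hU @` V).
Proof.
move=> hV UV; rewrite (lamV_ker_im (quotm_pi hU) hV).
suff -> : V `&` [set x | quotm_pi hU x = 0%R] = U by [].
apply/seteqP; split=> [x [_ /quotm_pi_eq0] //|x Ux].
by split; [exact: UV|apply/quotm_pi_eq0].
Qed.

Lemma lamV_le (V : set M) : submod V -> U `<=` V -> lamV lam U <= lamV lam V.
Proof.
move=> hV UV; rewrite (lamV_quot hV UV) leeDl //; apply: lamV_ge0.
exact: submod_image.
Qed.

End Quotient.

Lemma image_addsub (M M' : lmodType A) (U V : set M) (f : {linear M -> M})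
  (g : {linear M -> M'}) : submod U -> (forall u, U u -> g u = 0%R) ->
  g @` [set x | exists u v, [/\ U u, V v & x = (u + f v)%R]] = (g \o f) @` V.
Proof.
move=> hU gU; apply/seteqP; split=> _ [x Vx <-].
  by have [u [v [Uu Vv ->]]] := Vx; exists v => //=; rewrite linearD (gU u) // add0r.
exists (f x) => //; exists 0%R, x; split=> //; first exact: subm0.
by rewrite add0r.
Qed.

(** Modulo [U], the sum of [U] and [f @] V is the image of [V] under [f] followed by the
    projection. *)
Lemma lamV_addsub_quot (M : lmodType A) (U V : set M) (hU : submod U)
  (f : {linear M -> M}) : submod V ->
  lamV lam [set x | exists u v, [/\ U u, V v & x = (u + f v)%R]] =
  lamV lam U + lamV lam ((quotm_pi hU \o f) @` V).
Proof.
move=> hV; rewrite (lamV_quot hU); last 2 first.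
- exact: submod_addsub.
- by move=> u Uu; exists u, 0%R; split; rewrite ?linear0 ?addr0 //; exact: subm0.
by rewrite image_addsub // => u /(quotm_pi_eq0 hU).
Qed.

(** The supremum axiom gives a finitely generated submodule of [SubLmod hV]; the inclusion [v],
    being injective, carries it into [M] without changing its length. *)
Lemma lamV_fingen_approx (M : lmodType A) (V : set M) (e : Rr) : submod V ->
  lamV lam V < +oo -> (0 < e)%R -> exists W : set M,
  [/\ fingen W, W `<=` V & lamV lam V <= lamV lam W + e%:E].
Proof.
move=> hV fV e0; case: hlam => _ _ _ _ lam_sup.
have finV : lamV lam V \is a fin_num by rewrite ge0_fin_numE // lamV_ge0.
have : lamV lam V - e%:E < lamV lam V.
  by rewrite lteBlDr // lteDl // lte_fin.
rewrite {2}(lamVE hV) lam_sup => /ereal_sup_gt[_ [W [fgW ->]] lt_W].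
have [v Ev] : exists v : {linear SubLmod hV -> M}, v =1 @subm_val _ _ _.
  by apply: linear_pack.
have hW := fingen_submod fgW.
have img : v @` W `<=` V by move=> _ [x _ <-]; rewrite Ev; exact: subm_prop.
exists (v @` W); split=> //.
  case: fgW => s ->; exists (map v s).
  apply/seteqP; split; last first.
    apply: gen_sub_min; first exact: submod_image (gen_sub_submod _).
    by move=> _ /mapP[x xs ->]; exists x => //; apply: sub_gen_sub.
  move=> _ [x Wx <-].
  suff : gen_sub [set x | x \in s] `<=`
    [set x | gen_sub [set y | y \in map v s] (v x)] by exact.
  apply: gen_sub_min => [|y ys /=]; last first.
    by apply: sub_gen_sub; apply/mapP; exists y.
  have hG := gen_sub_submod [set y | y \in map v s].
  split=> [|a y z /= Gy Gz]; first by rewrite /= linear0; exact: subm0.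
  by rewrite linearP; exact: hG.2.
have -> : lamV lam (v @` W) = lamV lam W.
  rewrite (lamV_ker_im v hW).
  suff -> : lamV lam (W `&` [set x | v x = 0%R]) = 0 by rewrite add0e.
  have hK := submI hW (submod_ker v).
  rewrite (lamVE hK); case: hlam => _ lam0 _ _ _; apply: lam0.
  move=> [x [Wx vx]]; apply: subm_eq => /=; apply: subm_eq.
  by rewrite -Ev.
by rewrite -leeBlDr // ltW.
Qed.

End LengthFunction.

(** * The filtration by monomials *)

Section Filtration.
Variables (A : comPzRingType) (N : lmodType A) (k : nat).
Variables (xs : 'I_k -> {linear N -> N}) (hxs : commuting_ops xs).
Implicit Types (V W : set N) (a b : seq nat) (P Q : set (seq nat)).

Lemma xmon_linear e : linear (xmon xs e).
Proof.
rewrite /xmon => c u v; elim: (enum _) => //= i l ->.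
by elim: (e i) => //= m ->; rewrite linearP.
Qed.

HB.instance Definition _ e :=
  GRing.isLinear.Build A N N *:%R (xmon xs e) (xmon_linear e).

Local Notation X a := (xmon xs (fun i => nth 0%N a (nat_of_ord i))).

(** Commutation lets each power of [xs i] pass the operators of the other variables. *)
Lemma xmonD e f v :
  xmon xs (fun i => e i + f i)%N v = xmon xs e (xmon xs f v).
Proof.
rewrite /xmon; elim: (enum _) v => //= i l IH v; rewrite IH iterD.
congr iter; have comm j m w : xs i (iter m (xs j) w) = iter m (xs j) (xs i w).
  by elim: m => //= m <-; rewrite hxs.
elim: (f i) => //= m ->; move: (iter m _ _) => w.
by elim: l {IH} => //= j l <-; rewrite comm.
Qed.

Lemma xmon_addseq a b v : size a = size b -> X (addseq a b) v = X a (X b v).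
Proof.
move=> sab; rewrite -xmonD; congr (xmon xs _ v); apply/funext => i.
exact: nth_addseq.
Qed.

(** An arbitrary index set covers [Sn], the stages of a growing list of monomials, and all monomials
    below a given one. *)
Definition mspan P V : set N :=
  gen_sub [set w | exists a v, [/\ P a, V v & w = X a v]].

Lemma mspan_submod P V : submod (mspan P V).
Proof. exact: gen_sub_submod. Qed.

Lemma mspan_mono P Q V W : P `<=` Q -> V `<=` W -> mspan P V `<=` mspan Q W.
Proof.
move=> PQ VW; apply: gen_sub_mono => _ [a [v [Pa Vv ->]]].
by exists a, v; split; [exact: PQ|exact: VW|].
Qed.

Lemma mem_mspan P V a v : P a -> V v -> mspan P V (X a v).
Proof. by move=> Pa Vv; apply: sub_gen_sub; exists a, v. Qed.

Lemma mspan_xmon P Q V b v : (forall a, P a -> size a = size b) ->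
  (forall a, P a -> Q (addseq b a)) -> mspan P V v -> mspan Q V (X b v).
Proof.
move=> szP PQ; suff sub : mspan P V `<=` [set v | mspan Q V (X b v)] by exact: sub.
have hQ := mspan_submod Q V.
apply: gen_sub_min.
  split=> [|c x y /= Qx Qy]; first by rewrite /= linear0; exact: subm0.
  by rewrite linearP; exact: hQ.2.
move=> _ [a [u [Pa Vu ->]]] /=; rewrite -xmon_addseq ?szP //.
by apply: mem_mspan => //; exact: PQ.
Qed.

Lemma mspan_rcons s a V : submod V -> mspan [set b | b \in rcons s a] V =
  [set x | exists u v, [/\ mspan [set b | b \in s] V u, V v & x = u + X a v]].
Proof.
move=> hV; have hs := mspan_submod [set b | b \in s] V.
apply/seteqP; split.
  apply: gen_sub_min; first exact: submod_addsub.
  move=> _ [b [v [bs Vv ->]]]; move: bs; rewrite /= mem_rcons inE.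
  case/orP=> [/eqP ->|bs]; first by exists 0, v; rewrite add0r; split=> //; exact: subm0.
  exists (X b v), 0; rewrite linear0 addr0; split=> //; last exact: subm0.
  exact: mem_mspan.
have hr := mspan_submod [set b | b \in rcons s a] V.
move=> _ [u [v [su Vv ->]]]; apply: submD => //.
  apply: mspan_mono su => // b /= bs.
  by rewrite mem_rcons inE bs orbT.
by apply: mem_mspan => //=; rewrite mem_rcons mem_head.
Qed.

Lemma mdeg_nth a : size a = k -> mdeg (fun i : 'I_k => nth 0%N a i) = sumn a.
Proof. by move=> <-; rewrite /mdeg sumnE (big_nth 0%N) big_mkord. Qed.

Lemma Sn_mspan n V : Sn xs n V = mspan [set a | a \in monomials k n] V.
Proof.
apply/seteqP; split.
  have hM := mspan_submod [set a | a \in monomials k n] V.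
  apply: gen_sub_min => // _ [p [v [/allP pn [Vv ->]]]].
  rewrite /pact big_seq; apply: (big_ind (mspan _ V)) => [|x y|c /pn cn].
  - exact: subm0.
  - exact: submD.
  apply: submZ => //; pose a := [seq c.2 i | i <- enum 'I_k].
  have sa : size a = k by rewrite size_map size_enum_ord.
  have -> : c.2 = (fun i : 'I_k => nth 0%N a i).
    apply/funext => i; rewrite (nth_map i) ?size_enum_ord //.
    by rewrite nth_ord_enum.
  apply: mem_mspan => //=; rewrite mem_monomials sa eqxx.
  by rewrite /a sumnE big_map big_enum.
apply: gen_sub_mono => _ [a [v [/= an Vv ->]]].
move: an; rewrite mem_monomials => /andP[/eqP sa an].
exists [:: (1, fun i : 'I_k => nth 0%N a i)], v.
by rewrite /= mdeg_nth // an /pact big_seq1 scale1r.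
Qed.

Lemma Sn_submod n V : submod (Sn xs n V).
Proof. exact: gen_sub_submod. Qed.

Lemma Sn_monol n V W : V `<=` W -> Sn xs n V `<=` Sn xs n W.
Proof. by move=> VW; rewrite !Sn_mspan; apply: mspan_mono. Qed.

Lemma Sn_monor m n V : (m <= n)%N -> Sn xs m V `<=` Sn xs n V.
Proof.
move=> mn; rewrite !Sn_mspan; apply: mspan_mono => // a /=.
by rewrite !mem_monomials => /andP[-> /leq_trans ->].
Qed.

Lemma Sn_Sn m n V : Sn xs n (Sn xs m V) `<=` Sn xs (n + m) V.
Proof.
rewrite [Sn xs n _]Sn_mspan; apply: gen_sub_min; first exact: Sn_submod.
move=> _ [a [v [/= an Vv ->]]]; move: an Vv.
rewrite mem_monomials !Sn_mspan => /andP[/eqP sa an].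
apply: mspan_xmon => b /=; rewrite !mem_monomials => /andP[/eqP sb bm].
  by rewrite sb sa.
by rewrite size_addseq ?sumn_addseq ?sa ?sb // eqxx; exact: leq_add.
Qed.

(** The size condition excludes lists of other lengths, which [grlex] also compares. *)
Definition lowspan V a : set N := mspan [set b | size b = k /\ grlex b a] V.

(* The [v] for which [x^a v] contributes nothing new at position [a] of the
   monomial order (leading-coefficient submodules of Groebner basis theory). *)
Definition initker V a : set N := V `&` [set v | lowspan V a (X a v)].

Lemma initker_quot V a (hL : submod (lowspan V a)) :
  initker V a = V `&` [set v | (quotm_pi hL \o X a) v = 0].
Proof.
by apply/seteqP; split=> v [Vv Lv]; split=> //; apply/(quotm_pi_eq0 hL).
Qed.

Lemma initker_submod V a : submod V -> submod (initker V a).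
Proof.
move=> hV; rewrite (initker_quot (mspan_submod _ _)); apply: submI => //.
exact: (submod_ker (quotm_pi _ \o X a)).
Qed.

(** If x^a v is a combination of smaller monomials applied to [V], multiplying by x^c with b = c + a
    keeps it so, because the order is compatible with adding exponents. *)
Lemma initker_mono V a b : size a = k -> all2 leq a b ->
  initker V a `<=` initker V b.
Proof.
move=> sa /all2_leq_addseq[c sc ->] v [Vv Lv]; split=> //=.
rewrite xmon_addseq //; apply: mspan_xmon Lv => d [sd da].
  by rewrite sd sc.
split; first by rewrite size_addseq ?sc ?sa ?sd.
by apply: grlex_addseq; rewrite ?sc ?sa ?sd.
Qed.

Section Length.
Variables (lam : forall M : lmodType A, \bar Rr) (hlam : length_function lam).

Local Open Scope ereal_scope.

Lemma lamV_fin_num (M : lmodType A) (V : set M) : submod V ->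
  lamV lam V < +oo -> lamV lam V \is a fin_num.
Proof. by move=> hV fV; rewrite ge0_fin_numE // lamV_ge0. Qed.

(** The new stage modulo the old one is [V] modulo the displayed kernel; finiteness of the length of
    [V] makes the increment a real difference. *)
Lemma lamV_mspan_step s a V : submod V -> lamV lam V < +oo ->
  lamV lam (mspan [set b | b \in rcons s a] V) =
  lamV lam (mspan [set b | b \in s] V) +
  (fine (lamV lam V) -
   fine (lamV lam (V `&` [set v | mspan [set b | b \in s] V (X a v)])))%:E.
Proof.
move=> hV fV; have hs := mspan_submod [set b | b \in s] V.
rewrite mspan_rcons // (lamV_addsub_quot hlam hs) //; congr (_ + _).
have -> : V `&` [set v | mspan [set b | b \in s] V (X a v)] =
    V `&` [set v | (quotm_pi hs \o X a) v = 0%R].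
  by apply/seteqP; split=> v [Vv Lv]; split=> //; apply/(quotm_pi_eq0 hs).
have hK := submI hV (submod_ker (quotm_pi hs \o X a)).
have hI := submod_image (quotm_pi hs \o X a) hV.
have EV := lamV_ker_im hlam (quotm_pi hs \o X a) hV.
have fI := lamV_fin_num hI (le_lt_trans (lamV_image_le hlam _ hV) fV).
have fK := lamV_fin_num hK (le_lt_trans (lamV_le hlam hK hV (@subIsetl _ _ _)) fV).
rewrite EV fineD // [(fine _ + _)%R]addrC addrK.
by rewrite fineK.
Qed.

(** In an increasing, downward closed list the entries before [a] are exactly the exponents below
    [a], so the kernel of each step is [initker V a]. *)
Lemma lamV_mspan_sorted s V : submod V -> lamV lam V < +oo ->
  pairwise grlex s -> {in s, forall a, size a = k} ->
  (forall a b, a \in s -> size b = k -> grlex b a -> b \in s) ->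
  lamV lam (mspan [set b | b \in s] V) =
  (\sum_(a <- s) (fine (lamV lam V) - fine (lamV lam (initker V a))))%:E.
Proof.
move=> hV fV; elim/last_ind: s => [|s a IHs] sorted_s sz_s down_s.
  have hs := mspan_submod [set b | b \in [::]] V.
  rewrite big_nil (lamVE lam hs); case: hlam => _ lam0 _ _ _; apply: lam0.
  move=> [x sx]; apply: subm_eq => /=.
  have : mspan [set b | b \in [::]] V `<=` [set 0%R].
    apply: gen_sub_min => [|_ [b [v []]] //].
    by split=> // c _ _ -> ->; rewrite /= scaler0 addr0.
  exact.
move: sorted_s; rewrite pairwise_rcons => /andP[/allP lt_a sorted_s].
have down b : b \in s -> b \in rcons s a by rewrite mem_rcons inE orbC => ->.
have low_a : lowspan V a = mspan [set b | b \in s] V.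
  rewrite /lowspan; congr mspan; apply/seteqP; split=> b /=.
    move=> [sb ba]; have := down_s a b; rewrite !mem_rcons mem_head => /(_ isT sb ba).
    by rewrite inE => /orP[/eqP eb|//]; rewrite eb grlex_irr in ba.
  by move=> bs; split; [exact: sz_s (down _ bs)|exact: lt_a].
rewrite lamV_mspan_step // IHs //; last 2 first.
- by move=> b /down /sz_s.
- move=> b c bs sc cb; have := down_s b c (down _ bs) sc cb.
  rewrite mem_rcons inE => /orP[/eqP ec|//].
  have := grlex_trans cb (lt_a _ bs).
  by rewrite ec grlex_irr.
by rewrite -low_a -EFinD -cats1 big_cat big_seq1.
Qed.

(** Degree is compared first, so exponents of degree at most [n] are downward closed; sorting them
    does not alter the sum. *)
Lemma lamV_Sn_sum n V : submod V -> lamV lam V < +oo ->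
  lamV lam (Sn xs n V) = (\sum_(a <- monomials k n)
    (fine (lamV lam V) - fine (lamV lam (initker V a))))%:E.
Proof.
move=> hV fV; have [t tm sorted_t] := grlex_sort (uniq_monomials k n).
rewrite Sn_mspan -(perm_big _ tm) -lamV_mspan_sorted //.
- congr (lamV lam (mspan _ V)); apply/seteqP.
  by split=> a /=; rewrite (perm_mem tm).
- by move=> a; rewrite (perm_mem tm) mem_monomials => /andP[/eqP].
- move=> a b; rewrite !(perm_mem tm) !mem_monomials => /andP[_ an] -> ba.
  by rewrite eqxx (leq_trans (grlex_sumn ba)).
Qed.

Lemma hilb_poly_exists (hA : noetherian A) V : fingen V -> lamV lam V < +oo ->
  exists q : {poly Rr}, hilb_poly lam xs V q.
Proof.
move=> fgV fV; have hV := fingen_submod fgV.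
(* The chain condition is that of submodules of [V], and each monomial is weighted by its length
   increment. *)
have [||q [sq [n1 Hq]]] := @evpoly_monomials _ _ (fun W => submod W /\ W `<=` V)
  (fun W => fine (lamV lam V) - fine (lamV lam W))%R
  (fingen_acc hA fgV) k (initker V).
- by move=> a; split; [exact: initker_submod|move=> v []].
- exact: initker_mono.
by exists q; split=> //; exists n1 => n /Hq <-; exact: lamV_Sn_sum.
Qed.

(** Each monomial costs at most [e]: its kernel [L] in [W] lies in its kernel [K] in [V], so lam V -
    lam K is at most lam W + e - lam L. *)
Lemma lamV_mspan_approx s V W (e : Rr) : submod V -> submod W -> W `<=` V ->
  lamV lam V < +oo -> lamV lam V <= lamV lam W + e%:E ->
  lamV lam (mspan [set b | b \in s] V) <=
  lamV lam (mspan [set b | b \in s] W) + ((size s)%:R * e)%:E.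
Proof.
move=> hV hW WV fV VW; have fW := le_lt_trans (lamV_le hlam hW hV WV) fV.
elim/last_ind: s => [|s a IHs].
  rewrite mul0r adde0; suff -> : mspan [set b | b \in [::]] V =
    mspan [set b | b \in [::]] W by [].
  by rewrite /mspan; congr gen_sub; apply/seteqP; split=> w [b [v []]].
rewrite !lamV_mspan_step // size_rcons -natr1 mulrDl mul1r (EFinD (_ * _)%R) addeACA.
apply: leeD => //; rewrite -EFinD lee_fin.
set K := V `&` _; set L := W `&` _.
have LK : L `<=` K.
  move=> v [Wv sv]; split; first exact: WV.
  by apply: mspan_mono sv.
have hker U : submod U ->
    submod (U `&` [set v | mspan [set b | b \in s] U (X a v)]).
  move=> hU; have hs := mspan_submod [set b | b \in s] U.
  apply: submI => //; split=> [|c x y /= sx sy].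
    by rewrite /= linear0; exact: subm0.
  by rewrite linearP; exact: hs.2.
have hK : submod K by exact: hker.
have hL : submod L by exact: hker.
have fK := le_lt_trans (lamV_le hlam hK hV (@subIsetl _ _ _)) fV.
have leLK := lamV_le hlam hL hK LK.
have fL := le_lt_trans leLK fK.
have := fine_le (lamV_fin_num hL fL) (lamV_fin_num hK fK) leLK.
move: VW; rewrite -(fineK (lamV_fin_num hV fV)) -(fineK (lamV_fin_num hW fW)).
by rewrite -EFinD lee_fin /=; lra.
Qed.

Lemma lamV_Sn_approx n V W (e : Rr) : submod V -> submod W -> W `<=` V ->
  lamV lam V < +oo -> lamV lam V <= lamV lam W + e%:E ->
  lamV lam (Sn xs n V) <= lamV lam (Sn xs n W) + ('C(n + k, k)%:R * e)%:E.
Proof.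
move=> hV hW WV fV VW; rewrite !Sn_mspan -size_monomials.
exact: lamV_mspan_approx.
Qed.

End Length.
End Filtration.

(** * Asymptotics of polynomials *)

Section Asymptotics.
Import numFieldNormedType.Exports.
Variable R : realType.
Implicit Types (p q : {poly R}).

Lemma natr_unbounded (x : R) (n1 : nat) : exists2 n, (n1 <= n)%N & x <= n%:R.
Proof.
exists (maxn n1 (Num.bound `|x|)); first exact: leq_maxl.
rewrite (le_trans (ler_norm x)) // (le_trans (ltW (archi_boundP _))) //.
by rewrite ler_nat leq_maxr.
Qed.

(** Lengths are compared only at natural numbers; the sign of the leading coefficient is what
    carries the comparison to large reals. *)
Lemma lead_coef_ge0 p n1 : (forall n, (n1 <= n)%N -> 0 <= p.[n%:R]) ->
  0 <= lead_coef p.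
Proof.
move=> Hp; rewrite leNgt; apply/negP => lt0.
have : 0 < lead_coef (- p) by rewrite lead_coefN oppr_gt0.
move=> lN; have [x Hx] := poly_pinfty_gt_lc lN.
have [n n1n xn] := natr_unbounded x n1.
have := Hx _ xn; rewrite hornerN; have := Hp n n1n; lra.
Qed.

Lemma eventually_ge0 p : 0 <= lead_coef p ->
  exists t1, forall t, t1 <= t -> 0 <= p.[t].
Proof.
rewrite le_eqVlt eq_sym lead_coef_eq0 => /orP[/eqP ->|l0].
  by exists 0 => t _; rewrite horner0.
have [x Hx] := poly_pinfty_gt_lc l0.
by exists x => t /Hx; apply: le_trans; exact: ltW.
Qed.

(** Were [p] of larger size, [q - p] would have the leading coefficient of [- p], forcing
    [p = 0]. *)
Lemma size_le_of_lead_coef p q : 0 <= lead_coef p -> 0 <= lead_coef (q - p) ->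
  (size p <= size q)%N.
Proof.
move=> lp lqp; rewrite leqNgt; apply/negP => lt_qp.
move: lqp; rewrite addrC lead_coefDl ?size_polyN // lead_coefN oppr_ge0 => lp'.
have : lead_coef p = 0 by apply/le_anti; rewrite lp lp'.
by move/eqP; rewrite lead_coef_eq0 => /eqP p0; rewrite p0 size_poly0 in lt_qp.
Qed.

Lemma lead_coef_le p q : size p = size q -> 0 <= lead_coef (q - p) ->
  lead_coef p <= lead_coef q.
Proof.
move=> spq lqp; rewrite -subr_ge0.
have -> : lead_coef q - lead_coef p = (q - p)`_(size q).-1.
  by rewrite coefB !lead_coefE spq.
have := size_polyD q (- p); rewrite size_polyN spq maxnn.
(* Either the difference keeps full size and this is its leading coefficient, or the top terms
   cancel and it is zero. *)
rewrite leq_eqVlt => /orP[/eqP <- //|lt_s].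
by rewrite nth_default //; move: lt_s; case: (size q).
Qed.

Lemma shift_size q (c : R) : size (q \Po ('X + c%:P)) = size q.
Proof. by rewrite size_comp_poly2 // size_XaddC. Qed.

Lemma shift_lead_coef q (c : R) : lead_coef (q \Po ('X + c%:P)) = lead_coef q.
Proof.
by rewrite lead_coef_comp ?size_XaddC // lead_coefXaddC expr1n mulr1.
Qed.

Lemma shift_coef k q (c : R) : (size q <= k.+1)%N ->
  (q \Po ('X + c%:P))`_k = q`_k.
Proof.
rewrite leq_eqVlt => /orP[/eqP sq|sq].
  by have := shift_lead_coef q c; rewrite !lead_coefE shift_size sq.
by rewrite !nth_default // shift_size.
Qed.

(** The right side is (n+1)...(n+k), with every factor at least n+1. *)
Lemma expn_le_binomial k n : (n.+1 ^ k <= k`! * 'C(n + k, k))%N.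
Proof.
rewrite mulnC bin_ffact; elim: k => [|k IHk]; first by rewrite ffactn0.
by rewrite addnS ffactnS expnS leq_mul //= ltnS leq_addr.
Qed.

(** For positive [k], the numerator is at most M (n+1)^(k-1) in absolute value and the binomial at
    least (n+1)^k / k!, so the quotient is bounded by M k! / (n+1). For [k = 0] the polynomial is
    zero. *)
Lemma cvg_low_degree k p : (size p <= k)%N ->
  (fun n => p.[n%:R] / ('C(n + k, k))%:R) @ \oo --> (0 : R).
Proof.
move=> sp; pose M := \sum_(i < size p) `|p`_i| : R.
apply/norm_cvg0P; apply: (@squeeze_cvgr _ _ _ _ (fun=> 0)
  (fun n => (M * (k`!)%:R) * (n.+1%:R)^-1)).
- near=> n; rewrite normr_ge0 /=.
  case: k sp @M => [|k] sp M; first by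
    move: sp; rewrite leqn0 size_poly_eq0 => /eqP ->; rewrite horner0 mul0r normr0
      !mulr_ge0 // ?invr_ge0 // sumr_ge0.
  have C0 : 0 < ('C(n + k.+1, k.+1))%:R :> R by rewrite ltr0n bin_gt0 leq_addl.
  have n0 : 0 < n.+1%:R :> R by rewrite ltr0n.
  rewrite normrM normfV (gtr0_norm C0) ler_pdivrMr //.
  rewrite mulrAC ler_pdivlMr //.
  have le_p : `|p.[n%:R]| <= M * n.+1%:R ^+ k.
    rewrite horner_coef (le_trans (ler_norm_sum _ _ _)) // /M mulr_suml.
    apply: ler_sum => i _; rewrite normrM normrX ler_wpM2l //.
    rewrite (ger0_norm (ler0n _ _)) -!natrX ler_nat.
    apply: (@leq_trans (n.+1 ^ i)); first by
      case: (nat_of_ord i) => // j; rewrite leq_exp2r.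
    by rewrite leq_pexp2l // -ltnS (leq_trans (ltn_ord i)).
  apply: (le_trans (ler_wpM2r (ltW n0) le_p)).
  rewrite -!mulrA -exprSr -natrM -natrX ler_wpM2l ?sumr_ge0 //.
  by rewrite ler_nat expn_le_binomial.
- exact: cvg_cst.
- rewrite -[X in _ --> X](mulr0 (M * (k`!)%:R)); apply: cvgMr.
  exact: cvg_harmonic.
Unshelve. all: by end_near.
Qed.

Lemma cvg_hilbert k q : (size q <= k.+1)%N ->
  (fun n => q.[n%:R] / ('C(n + k, k))%:R) @ \oo --> (q`_k * (k`!)%:R : R).
Proof.
(* [b] is (X+1)...(X+k), monic of degree [k] with value k! C(n+k, k) at [n]; subtracting its
   multiple by the coefficient of degree [k] leaves a part that vanishes in the limit. *)
move=> sq; pose b : {poly R} := \prod_(i < k) ('X - (- i.+1%:R)%:P).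
have bn n : b.[n%:R] = (k`!)%:R * ('C(n + k, k))%:R.
  rewrite -natrM mulnC bin_ffact /b horner_prod.
  under eq_bigr => i _ do rewrite hornerXsubC opprK -natrD.
  rewrite -natr_prod; congr _%:R; elim: k {sq b} => [|k IHk].
    by rewrite big_ord0 ffactn0.
  by rewrite big_ord_recr /= IHk addnS ffactnS mulnC.
have sb : size b = k.+1.
  by rewrite size_prod_XsubC -sum1_size sum1_card card_ord.
have bk : b`_k = 1.
  have := monic_prod_XsubC (index_enum 'I_k) xpredT (fun i => - i.+1%:R : R).
  by rewrite monicE lead_coefE -/b sb => /eqP.
have sr : (size (q - q`_k *: b)%R <= k)%N.
  apply/leq_sizeP => j; rewrite leq_eqVlt => /orP[/eqP <-|kj].
    by rewrite coefB coefZ bk mulr1 subrr.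
  rewrite coefB coefZ (nth_default _ (leq_trans sq kj)).
  by rewrite [b`_j]nth_default ?sb // mulr0 subr0.
have := cvgD (cvg_low_degree sr) (cvg_cst (q`_k * (k`!)%:R)).
rewrite add0r => cvg0; apply: cvg_trans (cvg0 _ _); apply: near_eq_cvg; near=> n => /=.
have C0 : ('C(n + k, k))%:R != 0 :> R by rewrite pnatr_eq0 -lt0n bin_gt0 leq_addl.
rewrite fctE hornerD hornerN hornerZ bn; field.
by [].
Unshelve. all: by end_near.
Qed.

Lemma cvg_hilbert_ereal k q : (size q <= k.+1)%N ->
  (fun n => (q.[n%:R])%:E * ((('C(n + k, k))%:R)^-1)%:E)%E @ \oo -->
  ((q`_k * (k`!)%:R)%:E : \bar R).
Proof.
move=> sq; under eq_fun do rewrite -EFinM.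
by apply: cvg_EFin; [exact: nearW|exact: cvg_hilbert].
Qed.

End Asymptotics.

(** * Comparison of Hilbert polynomials and entropy *)

Section Comparison.
Variables (A : comPzRingType) (N : lmodType A) (k : nat).
Variables (xs : 'I_k -> {linear N -> N}) (hxs : commuting_ops xs).
Variables (lam : forall M : lmodType A, \bar Rr) (hlam : length_function lam).
Implicit Types (V W : set N) (q : {poly Rr}).

Lemma fingen_sub_Sn V W : SV xs V = [set: N] -> fingen W ->
  exists n, W `<=` Sn xs n V.
Proof.
move=> VN fgW; apply: fingen_chain fgW _.
- by move=> n; exact: Sn_submod.
- by move=> m n; exact: Sn_monor.
- by move=> w _; rewrite -/(SV xs V) VN.
Qed.

Lemma Sn_sub_shift n0 n V W : W `<=` Sn xs n0 V -> Sn xs n W `<=` Sn xs (n + n0) V.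
Proof.
move=> WV; apply: subset_trans (@Sn_Sn _ _ _ _ hxs n0 n V).
exact: Sn_monol.
Qed.

Lemma hilb_poly_lead_ge0 V q : hilb_poly lam xs V q -> 0 <= lead_coef q.
Proof.
move=> [_ [n1 Hq]]; apply: (@lead_coef_ge0 _ _ n1) => n /Hq E.
by rewrite -lee_fin -E; apply: lamV_ge0 => //; exact: Sn_submod.
Qed.

Lemma hilb_poly_coef_ge0 V q : hilb_poly lam xs V q -> 0 <= q`_k.
Proof.
move=> hq; have := hilb_poly_lead_ge0 hq; case: hq => + _.
rewrite leq_eqVlt => /orP[/eqP sq|sq]; first by rewrite lead_coefE sq.
by rewrite nth_default.
Qed.

Lemma hilb_poly_compare V W q r : SV xs V = [set: N] -> fingen W ->
  hilb_poly lam xs V q -> hilb_poly lam xs W r ->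
  exists n0 : nat, 0 <= lead_coef (q \Po ('X + n0%:R%:P) - r).
Proof.
move=> VN fgW [_ [n1 Hq]] [_ [n2 Hr]]; have [n0 WV] := fingen_sub_Sn VN fgW.
exists n0; apply: (@lead_coef_ge0 _ _ (n1 + n2)%N) => n le_n.
rewrite hornerD hornerN horner_comp !hornerE -natrD subr_ge0 -lee_fin.
rewrite -Hq; last by lia.
rewrite -Hr; last by lia.
by apply: lamV_le; [|exact: Sn_submod|exact: Sn_submod|exact: Sn_sub_shift].
Qed.

Local Open Scope ereal_scope.

Lemma Hent_hilb_poly V q : hilb_poly lam xs V q ->
  Hent lam xs V = (q`_k * (k`!)%:R)%:E.
Proof.
move=> [sq [n1 Hq]]; apply: cvg_lim => //.
apply: cvg_trans (cvg_hilbert_ereal sq); apply: near_eq_cvg.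
by exists n1 => // n /= /Hq ->.
Qed.

Lemma Hent_le V W q : SV xs V = [set: N] -> hilb_poly lam xs V q ->
  submod W -> lamV lam W < +oo -> Hent lam xs W <= (q`_k * (k`!)%:R)%:E.
Proof.
move=> VN hq hW fW; have q0 := hilb_poly_coef_ge0 hq; case: hq => sq [n1 Hq].
(* Without convergence the limit would be the default value 0, and the bound would follow from
   [q0]. *)
rewrite /Hent; have [cvgW|/dvgP ->] := pselect (cvg ((fun n => lamV lam (Sn xs n W) *
    ((('C(n + k, k))%:R : Rr)^-1)%:E) @ \oo)); last first.
  by rewrite lee_fin mulr_ge0.
apply/lee_addgt0Pr => e e0.
have [U [fgU UW WU]] := lamV_fingen_approx hlam hW fW e0.
have [n0 UV] := fingen_sub_Sn VN fgU.
(* The shift pays for the inclusion of [U] in [Sn xs n0 V] and leaves the coefficient of degree [k]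
   unchanged. *)
pose qs := (q \Po ('X + n0%:R%:P))%R.
have sqs : (size qs <= k.+1)%N by rewrite shift_size.
have cvgU : (fun n => (qs.[n%:R])%:E * ((('C(n + k, k))%:R)^-1)%:E + e%:E) @ \oo
    --> (q`_k * (k`!)%:R)%:E + e%:E.
  apply: cvgeD => //; last exact: cvg_cst.
  by rewrite -(shift_coef n0%:R sq); exact: cvg_hilbert_ereal.
rewrite -(cvg_lim _ cvgU) //.
apply: lee_lim => //; first by apply/cvg_ex; exists ((q`_k * (k`!)%:R)%:E + e%:E).
exists n1 => // n /= n1n.
have C0 : (0 < ('C(n + k, k))%:R :> Rr)%R by rewrite ltr0n bin_gt0 leq_addl.
have le_n : lamV lam (Sn xs n W) <= (qs.[n%:R] + ('C(n + k, k))%:R * e)%:E.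
  apply: (le_trans (lamV_Sn_approx xs hlam n hW (fingen_submod fgU) UW fW WU)).
  rewrite EFinD leeD2r // /qs horner_comp !hornerE -natrD -Hq; last by lia.
  by apply: lamV_le; [|exact: Sn_submod|exact: Sn_submod|exact: Sn_sub_shift].
apply: (le_trans (lee_wpmul2r _ le_n)); first by rewrite lee_fin invr_ge0 ltW.
rewrite -!EFinM -EFinD lee_fin mulrDl mulrAC divff ?mul1r //.
exact: lt0r_neq0.
Qed.

(** The supremum is attained at [V] itself. *)
Lemma hent_hilb_poly V q : submod V -> lamV lam V < +oo ->
  SV xs V = [set: N] -> hilb_poly lam xs V q ->
  hent lam xs = (q`_k * (k`!)%:R)%:E.
Proof.
move=> hV fV VN hq; apply/le_anti/andP; split.
  by apply: ge_ereal_sup => _ [W [hW fW ->]]; exact: Hent_le hq hW fW.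
by rewrite -(Hent_hilb_poly hq); apply: ereal_sup_ubound; exists V.
Qed.

End Comparison.

Theorem theorem4p10
  (A : comPzRingType) (hA : noetherian A)
  (lam : forall M : lmodType A, \bar Rr) (hlam : length_function lam)
  (k : nat) (N : lmodType A) (xs : 'I_k -> {linear N -> N})
  (hxs : commuting_ops xs) :
  (forall V0 : set N, fingen V0 -> (lamV lam V0 < +oo)%E ->
     exists q : {poly Rr}, hilb_poly lam xs V0 q) /\
  (forall (V0 V0' : set N) (q q' : {poly Rr}),
     fingen V0 -> (lamV lam V0 < +oo)%E -> SV xs V0 = [set: N] ->
     fingen V0' -> (lamV lam V0' < +oo)%E -> SV xs V0' = [set: N] ->
     hilb_poly lam xs V0 q -> hilb_poly lam xs V0' q' ->
     [/\ (exists (n0 : nat) (t1 : Rr), forall t : Rr, t1 <= t ->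
            q'.[t] <= q.[t + n0%:R]),
         size q = size q',
         lead_coef q = lead_coef q'
       & (q`_k)%:E = (hent lam xs * ((k`!)%:R^-1 : Rr)%:E)%E]).
Proof.
split=> [V0 fgV fV|V V' q q' fgV fV VN fgV' fV' VN' hq hq'].
  exact: hilb_poly_exists.
have lq := hilb_poly_lead_ge0 hlam hq.
have lq' := hilb_poly_lead_ge0 hlam hq'.
(* Comparison runs both ways, and shifting the argument affects neither size nor leading
   coefficient, so both must agree. *)
have [n0 lqq'] := hilb_poly_compare hxs hlam VN fgV' hq hq'.
have [m0 lq'q] := hilb_poly_compare hxs hlam VN' fgV hq' hq.
have sqq' : size q = size q'.
  apply/eqP; rewrite eqn_leq.
  have := size_le_of_lead_coef lq lq'q; rewrite shift_size => ->.
  by have := size_le_of_lead_coef lq' lqq'; rewrite shift_size => ->.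
split=> //.
- have [t1 Ht1] := eventually_ge0 lqq'; exists n0, t1 => t /Ht1.
  by rewrite hornerD hornerN horner_comp !hornerE subr_ge0.
- apply/le_anti/andP; split.
    by rewrite -(shift_lead_coef q' m0%:R) lead_coef_le // shift_size.
  by rewrite -(shift_lead_coef q n0%:R) lead_coef_le // shift_size.
- rewrite (hent_hilb_poly hxs hlam (fingen_submod fgV) fV VN hq) -EFinM.
  by rewrite mulfK // pnatr_eq0 -lt0n fact_gt0.
Qed.
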